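(* Let $A$ be a commutative $\mathbb Q$-algebra with unit, $M$ a free $A$-module of rank $r$, and $f\in\mathrm{End}_A(M)$ with characteristic polynomial $\det(t\,\mathrm{id}_M-f)=t^r-e_1t^{r-1}+\ldots+(-1)^re_r$. Then, in $\mathrm{End}_A(M)[[t]]$, \[ \exp(ft)=v_0(t)\,\mathrm{id}_M+v_1(t)f+\cdots+v_{r-1}(t)f^{r-1}, \] where, for $0\le j\le r-1$, $v_j(t)\in A[[t]]$ is the unique solution in $A[[t]]$ of the linear ODE \[ y^{(r)}(t)-e_1y^{(r-1)}(t)+\ldots+(-1)^re_r\,y(t)=0 \] with the initial conditions $v_j^{(i)}(0)=\delta_{ij}$, $0\leq i\leq r-1$.
   Context: $\exp(ft):=\sum_{n\ge0}f^n\frac{t^n}{n!}\in\mathrm{End}_A(M)[[t]]$, with $f^0=\mathrm{id}_M$. Derivatives $y^{(k)}$ are formal derivatives of power series with respect to $t$, and $\delta_{ij}$ is the Kronecker delta. *)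

(* Defs.v *)
From HB Require Import structures.
From mathcomp Require Import all_boot all_order all_algebra.
From mathcomp Require Import boolp functions.

Set Implicit Arguments.
Unset Strict Implicit.
Unset Printing Implicit Defensive.

Import GRing.Theory.
Local Open Scope ring_scope.

(* V[[t]], a series being the sequence of its coefficients. Only the
   coefficientwise module structure of nat -> V is exported: the library's
   pointwise product on nat -> V is not the product of power series. *)
Definition fps (V : Type) : Type := nat -> V.

HB.instance Definition _ (V : zmodType) :=
  GRing.Zmodule.copy (fps V) (nat -> V).
HB.instance Definition _ (R : pzRingType) (V : lmodType R) :=
  GRing.Lmodule.copy (fps V) (nat -> V).

Definition fps_deriv (V : zmodType) (y : fps V) : fps V :=
  fun n => y n.+1 *+ n.+1.

Definition fps_derivn (k : nat) (V : zmodType) (y : fps V) : fps V :=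
  iter k (@fps_deriv V) y.

(* y(0) *)
Definition fps_at0 (V : Type) (y : fps V) : V := y 0%N.

(* v(t) g in V[[t]], for v(t) in R[[t]] and g in V *)
Definition fps_smul (R : pzRingType) (V : lmodType R) (v : fps R^o) (g : V) :
    fps V :=
  fun n => (v n : R) *: g.

Section Endomorphisms.

(* A vectType over a commutative ring is a free module of finite rank
   [dim M], given with a coordinate isomorphism onto 'rV_(dim M). *)
Variables (R : comNzRingType) (M : vectType R).

(* 'End(M) has no canonical ring structure in the library (M may be 0). *)
Definition end_exp (f : 'End(M)) (n : nat) : 'End(M) :=
  iter n (comp_lfun f) (id_lfun M).

(* det (t id_M - f), computed in the coordinates carried by M. [f2mx f] acts on
   row vectors, so it is the transpose of the usual matrix of f; neither this
   nor the choice of coordinates affects the determinant. *)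
Definition end_char_poly (f : 'End(M)) : {poly R} :=
  char_poly (VectorInternalTheory.f2mx f).

End Endomorphisms.

(* exp(f t); 1/n! is taken in rat and mapped to A by the algebra structure. *)
Definition fps_exp (A : comAlgType rat) (M : vectType A) (f : 'End(M)) :
    fps 'End(M) :=
  fun n => ((n`!%:R^-1 : rat)%:A : A) *: end_exp f n.

(* y^(r) - e_1 y^(r-1) + ... + (-1)^r e_r y = 0 *)
Definition char_ode (R : comNzRingType) (r : nat) (e : nat -> R)
    (y : fps R^o) : Prop :=
  fps_derivn r y
    + \sum_(1 <= i < r.+1) ((-1) ^+ i * e i) *: fps_derivn (r - i) y = 0.

Definition char_ode_init (R : comNzRingType) (r : nat) (e : nat -> R)
    (j : 'I_r) (y : fps R^o) : Prop :=
  char_ode r e y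
    /\ forall i : 'I_r, fps_at0 (fps_derivn i y) = (i == j)%:R :> R.

(* Main.v *)
(** In terms of the scaled coefficients [n! y_n], the ODE is a linear recurrence
    of order [r] with constant coefficients, whose solution is determined by its
    first [r] terms. The powers of [f] satisfy this recurrence by
    Cayley-Hamilton, and so does the coefficient of index [j] of the remainder
    of ['X^n] modulo the characteristic polynomial; comparing initial terms
    expresses [f^n] through [1, f, ..., f^(r-1)]. *)
Require Import Defs.
From HB Require Import structures.
From mathcomp Require Import all_boot all_order all_algebra.
From mathcomp Require Import boolp functions.

Set Implicit Arguments.
Unset Strict Implicit.
Unset Printing Implicit Defensive.

Import GRing.Theory VectorInternalTheory.
Local Open Scope ring_scope.

Section LinearRecurrence.
Variables (R : pzRingType) (V : lmodType R) (r : nat) (c : nat -> R).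

Definition linrec (a : nat -> V) : Prop :=
  forall n, a (n + r)%N + \sum_(1 <= i < r.+1) c i *: a (n + (r - i))%N = 0.

Lemma linrec_unique (a b : nat -> V) :
  linrec a -> linrec b -> (forall n, (n < r)%N -> a n = b n) -> a =1 b.
Proof.
move=> ha hb hab n; elim/ltn_ind: n => n IHn.
have [/hab//|le_rn] := ltnP n r.
have := etrans (ha (n - r)%N) (esym (hb (n - r)%N)); rewrite subnK //.
rewrite (_ : \sum_(1 <= i < r.+1) c i *: a (n - r + (r - i))%N =
             \sum_(1 <= i < r.+1) c i *: b (n - r + (r - i))%N).
  exact: addIr.
rewrite big_nat [RHS]big_nat; apply: eq_bigr => i /andP[i_gt0 le_ir].
by rewrite IHn // -ltn_subRL subKn // ltn_subrL i_gt0 (leq_trans i_gt0).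
Qed.

End LinearRecurrence.

(** Differentiating [k] times produces the factor [(n+k)!/n!]; scaling by [n!] avoids the division,
    in any abelian group. *)
Lemma fps_derivnE (V : zmodType) (k : nat) (y : fps V) (n : nat) :
  fps_derivn k y n *+ n`! = y (n + k)%N *+ (n + k)`!.
Proof.
rewrite /fps_derivn; elim: k y n => [|k IHk] y n; first by rewrite addn0.
by rewrite iterSr IHk /fps_deriv -mulrnA -factS addnS.
Qed.

Lemma rat_alg_factK (A : comAlgType rat) (V : lmodType A) (n : nat) (x : V) :
  ((n`!%:R^-1 : rat)%:A : A) *: x *+ n`! = x.
Proof.
rewrite -scaler_nat scalerA -[_%:R in X in X *: _]scaler_nat -scalerAl mul1r.
by rewrite scalerA divff ?scale1r // Num.Theory.pnatr_eq0 -lt0n fact_gt0.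
Qed.

Lemma mulrn_fact_inj (A : comAlgType rat) (V : lmodType A) (n : nat) :
  injective (fun x : V => x *+ n`!).
Proof.
move=> x y /= exy.
by rewrite -[x](rat_alg_factK n) -[y](rat_alg_factK n) !scalerMnr exy.
Qed.

(** Coefficient [n] of the left side of the ODE, times [n!], is the left side of the recurrence at
    [n]. The converse cancels [n!], which is invertible in a [rat]-algebra. *)
Lemma char_odeP (A : comAlgType rat) (r : nat) (e : nat -> A) (y : fps A^o) :
  char_ode r e y <->
  linrec r (fun i => (-1) ^+ i * e i) (fun n => y n *+ n`! : A^o).
Proof.
have ode_coef n : (fps_derivn r y + \sum_(1 <= i < r.+1)
      ((-1) ^+ i * e i) *: fps_derivn (r - i) y) n *+ n`! =
    y (n + r)%N *+ (n + r)`! + \sum_(1 <= i < r.+1)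
      ((-1) ^+ i * e i) *: (y (n + (r - i))%N *+ (n + (r - i))`! : A^o).
  rewrite fct_sumE /= mulrnDl fps_derivnE -sumrMnl; congr (_ + _).
  by apply: eq_bigr => i _; rewrite -fps_derivnE scalerMnr.
split=> [ode n | rec]; first by rewrite -ode_coef ode mul0rn.
apply/funext => n; apply: (@mulrn_fact_inj _ A^o n).
by rewrite /= ode_coef rec mul0rn.
Qed.

Lemma char_ode_init_inj (A : comAlgType rat) (r : nat) (e : nat -> A)
    (j : 'I_r) (y z : fps A^o) :
  char_ode_init e j y -> char_ode_init e j z -> y = z.
Proof.
move=> [/char_odeP recy y0] [/char_odeP recz z0]; apply/funext => n.
apply: (@mulrn_fact_inj _ A^o n); apply: (linrec_unique recy recz) => i lt_ir.
have := etrans (y0 (Ordinal lt_ir)) (esym (z0 (Ordinal lt_ir))).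
by rewrite -!(fps_derivnE i _ 0) /fps_at0 /= => ->.
Qed.

Lemma iter_mulmxr_Cayley_Hamilton (R : comNzRingType) (d r : nat)
    (B : 'M[R]_d) (c : nat -> R) (w : 'rV[R]_d) :
    char_poly B = 'X^r + \sum_(1 <= i < r.+1) c i *: 'X^(r - i) ->
  iter r (mulmxr B) w + \sum_(1 <= i < r.+1) c i *: iter (r - i) (mulmxr B) w
    = 0.
Proof.
(* In size 0 the only row vector is zero; in positive size the iterates are products with powers of
   [B]. *)
case: d => [|d] in B w *; first by move=> _; rewrite [LHS]thinmx0.
have iterE k : iter k (mulmxr B) w = w *m B ^+ k.
  elim: k => [|k IHk]; first by rewrite mulmx1.
  by rewrite iterS IHk /= -mulmxA exprSr.
move=> /(congr1 (horner_mx B)); rewrite Cayley_Hamilton => CH.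
rewrite -[RHS](mulmx0 _ w) CH rmorphD rmorphXn /= horner_mx_X mulmxDr iterE.
rewrite raddf_sum mulmx_sumr; congr (_ + _); apply: eq_bigr => i _.
by rewrite /= linearZ rmorphXn /= horner_mx_X iterE scalemxAr.
Qed.

Section PowersOfEndomorphism.
Variables (R : comNzRingType) (M : vectType R) (f : 'End(M)).
Variables (r : nat) (c : nat -> R).

Lemma v2r_end_exp (n : nat) (u : M) :
  v2r (end_exp f n u) =
  iter n (mulmxr (f2mx f)) (v2r u).
Proof.
elim: n => [|n IHn]; first by rewrite id_lfunE.
rewrite /= -IHn comp_lfunE; move: (end_exp f n u) => w.
by rewrite unlock /= r2vK.
Qed.

(** Evaluated at [u] and read in coordinates, the recurrence at [n] is the Cayley-Hamilton relation
    for the vector [f^n u]. *)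
Lemma linrec_end_exp :
  end_char_poly f = 'X^r + \sum_(1 <= i < r.+1) c i *: 'X^(r - i) ->
  linrec r c (end_exp f).
Proof.
move=> /iter_mulmxr_Cayley_Hamilton CH n; apply/lfunP => u.
apply: v2r_inj.
rewrite add_lfunE sum_lfunE zero_lfunE raddfD raddf_sum /= !raddf0.
rewrite -[RHS](CH (v2r (end_exp f n u))) v2r_end_exp.
rewrite v2r_end_exp -iterD addnC; congr (_ + _); apply: eq_bigr => i _.
by rewrite scale_lfunE linearZ /= v2r_end_exp -iterD addnC.
Qed.

End PowersOfEndomorphism.

Section PowersModuloMonic.
Variables (R : comNzRingType) (p : {poly R}) (r : nat) (c : nat -> R).
Hypotheses (mon_p : p \is monic) (size_p : size p = r.+1).
Hypothesis pE : p = 'X^r + \sum_(1 <= i < r.+1) c i *: 'X^(r - i).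

(** For [p] monic of degree [r], these are the coordinates of the class of ['X^n] modulo [p] in the
    basis of the powers of ['X] below [r]. *)
Definition Xn_mod_coef (j n : nat) : R^o := (Pdiv.Ring.rmodp 'X^n p)`_j.

(** The product ['X^n * p] leaves remainder 0, and the remainder modulo a monic polynomial is linear
    in the dividend. *)
Lemma linrec_Xn_mod_coef (j : nat) : linrec r c (Xn_mod_coef j).
Proof.
move=> n; have := Pdiv.RingMonic.rmodp_mull mon_p 'X^n.
rewrite [X in Pdiv.Ring.rmodp (_ * X) _]pE mulrDr -exprD mulr_sumr.
rewrite Pdiv.RingMonic.rmodpD // Pdiv.RingMonic.rmodp_sum //.
move=> /(congr1 (fun q : {poly R} => q`_j)); rewrite coefD coef_sum coef0.
move=> mod0; rewrite -[RHS]mod0; congr (_ + _); apply: eq_bigr => i _.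
by rewrite -scalerAr -exprD Pdiv.RingMonic.rmodpZ // coefZ.
Qed.

Lemma Xn_mod_coef_small (j i : nat) :
  (i < r)%N -> Xn_mod_coef j i = (j == i)%:R.
Proof.
move=> lt_ir; rewrite /Xn_mod_coef Pdiv.Ring.rmodp_small ?coefXn //.
by rewrite size_polyXn size_p ltnS.
Qed.

End PowersModuloMonic.

Theorem corollary1p6 (A : comAlgType rat) (M : vectType A) (r : nat)
    (hr : dim M = r) (f : 'End(M)) (e : nat -> A)
    (he : end_char_poly f
          = 'X^r + \sum_(1 <= i < r.+1) ((-1) ^+ i * e i) *: 'X^(r - i)) :
  exists v : 'I_r -> fps A^o,
    (forall j : 'I_r, unique (char_ode_init e j) (v j))
    /\ fps_exp f = \sum_(j < r) fps_smul (v j) (end_exp f j).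
Proof.
pose p := end_char_poly f; pose c i := (-1) ^+ i * e i.
have mon_p : p \is monic by apply: char_poly_monic.
have size_p : size p = r.+1 by rewrite size_char_poly hr.
pose a := Xn_mod_coef p.
have rec_a j : linrec r c (a j) by apply: linrec_Xn_mod_coef.
(* [v j] is the exponential generating function of [a j], so its scaled coefficients are the
   [a j n]. *)
pose v (j : 'I_r) : fps A^o := fun n => ((n`!%:R^-1 : rat)%:A : A) *: a j n.
have vK j n : v j n *+ n`! = a j n by apply: rat_alg_factK.
exists v; split=> [j|].
  have vj_init : char_ode_init e j (v j).
    split=> [|i].
      apply/char_odeP => n; rewrite !vK -[RHS](rec_a j n).
      by congr (_ + _); apply: eq_bigr => i _; rewrite vK.
    (* Inserting [1 = 0!] lets [fps_derivnE] turn the initial value into [i!] times coefficient [i],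
       that is [a j i]. *)
    rewrite /fps_at0 -[LHS](mulr1n) (fps_derivnE i _ 0) vK.
by rewrite /a (Xn_mod_coef_small size_p) ?ltn_ord // eq_sym.
  by split=> // y; apply: char_ode_init_inj.
have rec_comb : linrec r c (fun n => \sum_(j < r) (a j n : A) *: end_exp f j).
  move=> n; under [X in _ + X]eq_bigr do rewrite scaler_sumr.
  rewrite exchange_big -big_split big1 //= => j _.
  under eq_bigr do rewrite scalerA.
  by rewrite -scaler_suml -scalerDl [X in X *: _](rec_a j n) scale0r.
(* Coefficient [n] of both sides carries the factor [1/n!]; what remains is that [f^n] is the sum of
   the [a j n] times [f^j]. *)
apply/funext => n; rewrite fct_sumE /fps_smul /v /fps_exp.
under [RHS]eq_bigr do rewrite -scalerA.
rewrite -scaler_sumr; congr (_ *: _).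
apply: (linrec_unique (linrec_end_exp he) rec_comb) => i lt_ir.
(* Below [r], ['X^i] is its own remainder, so only the term [j = i] survives. *)
rewrite (bigD1 (Ordinal lt_ir)) //= /a (Xn_mod_coef_small size_p) // eqxx.
rewrite scale1r big1 ?addr0 // => j /negPf ji.
rewrite (Xn_mod_coef_small size_p) // -[_ == i]/(j == Ordinal lt_ir) ji.
by rewrite scale0r.
Qed.
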